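(* Let $G$ be a profinite group. Then the following are equivalent: (i) $G$ is a profinite-$C$ group; (ii) $G=B\ltimes A$, where $B=\mathrm{Cr}_{j\in J}\,\langle b_j\rangle$ and $A=\mathrm{Cr}_{i\in I}\,\langle a_i\rangle$ are closed subgroups of $G$ (internal cartesian products), all elements $b_j$ and $a_i$ have prime order, and $\langle a_i\rangle\trianglelefteq G$ for every $i\in I$. Furthermore, if these properties hold, then $A$ can be chosen to be $\overline{G'}$, the topological closure of the derived subgroup $G'$ of $G$.
   Context: A permutable complement of a subgroup $H$ of a group $G$ is a subgroup $K$ with $G=HK$ and $H\cap K=1$. A profinite group $G$ is a profinite-$C$ group if every closed subgroup of $G$ has a closed permutable complement in $G$. A profinite group $G$ is the internal cartesian product of a family $\{H_i\}_{i\in I}$ of its subgroups, written $G=\mathrm{Cr}_{i\in I}\,H_i$, if: each $H_i$ is a closed normal subgroup of $G$; $G$ is the topological closure of $\langle H_i\mid i\in I\rangle$; and $\bigcap_{i\in I}\overline{\langle H_j\mid j\ne i\rangle}=1$. (Such a group is topologically isomorphic to the external cartesian product of the $H_i$.) *)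

(* Defs.v *)
From HB Require Import structures.
From mathcomp Require Import all_boot monoid.
From mathcomp Require Import boolp classical_sets topology.

Set Implicit Arguments.
Unset Strict Implicit.
Unset Printing Implicit Defensive.

Local Open Scope classical_set_scope.
Local Open Scope group_scope.

#[short(type="topGroupType")]
HB.structure Definition TopGroup := {G of Group G & Topological G}.

Definition profinite (G : topGroupType) : Prop :=
  continuous (fun p : G * G => (p.1 * p.2)%g) /\
  continuous (fun x : G => (x^-1)%g) /\
  hausdorff_space G /\ compact [set: G] /\ totally_disconnected [set: G].

Section Defs.
Variable G : topGroupType.

Definition is_subgroup (H : set G) : Prop :=
  H 1 /\ (forall x y, H x -> H y -> H (x * y)) /\ (forall x, H x -> H (x^-1)).

Definition closed_subgroup (H : set G) : Prop := is_subgroup H /\ closed H.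

Definition normal_in (H X : set G) : Prop :=
  is_subgroup H /\ is_subgroup X /\ H `<=` X /\
  (forall x h, X x -> H h -> H (x^-1 * h * x)).

Definition setmul (H K : set G) : set G :=
  [set g | exists h k, H h /\ K k /\ g = h * k].

Definition perm_complement (H K : set G) : Prop :=
  is_subgroup K /\ setmul H K = [set: G] /\ H `&` K = [set 1].

Definition profinite_C : Prop :=
  forall H : set G, closed_subgroup H ->
    exists K : set G, closed_subgroup K /\ perm_complement H K.

Definition gen (S : set G) : set G :=
  [set g | forall H : set G, is_subgroup H -> S `<=` H -> H g].

Definition cyc (x : G) : set G := gen [set x].

Definition has_order (x : G) (n : nat) : Prop :=
  (0 < n)%N /\ x ^+ n = 1 /\ (forall m, (0 < m)%N -> (m < n)%N -> x ^+ m <> 1).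

Definition prime_order (x : G) : Prop := exists p, prime p /\ has_order x p.

Definition int_cart_prod (I : Type) (H : I -> set G) (X : set G) : Prop :=
  (forall i, closed (H i) /\ normal_in (H i) X) /\
  X = closure (gen (\bigcup_(i in [set: I]) H i)) /\
  X `&` \bigcap_(i in [set: I]) closure (gen (\bigcup_(j in [set j | j <> i]) H j))
    = [set 1].

Definition semidirect (B A : set G) : Prop :=
  is_subgroup B /\ normal_in A [set: G] /\
  setmul B A = [set: G] /\ B `&` A = [set 1].

Definition derived : set G := gen [set g | exists x y : G, g = x^-1 * y^-1 * x * y].

Definition decomposition (A : set G) : Prop :=
  exists (B : set G) (J I : Type) (b : J -> G) (a : I -> G),
    closed_subgroup B /\ closed_subgroup A /\ semidirect B A /\
    int_cart_prod (fun j => cyc (b j)) B /\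
    int_cart_prod (fun i => cyc (a i)) A /\
    (forall j, prime_order (b j)) /\ (forall i, prime_order (a i)) /\
    (forall i, normal_in (cyc (a i)) [set: G]).

End Defs.

(* Main.v *)
Require Import Defs.
From HB Require Import structures.
From mathcomp Require Import all_boot all_fingroup all_solvable monoid.

Set Implicit Arguments.
Unset Strict Implicit.
Unset Printing Implicit Defensive.

(** A finite group in which every subgroup has a complement is solvable: an
    element of smallest prime order [p] has a complement of index [p], which is
    normal.  If [A] is a maximal abelian normal subgroup, then complements show
    that [A] is generated by cyclic subgroups normal in the whole group, so the
    derived subgroup centralizes [A]; solvability and maximality give
    [C(A) = A], hence the derived subgroup is abelian.  Coset actions on open
    subgroups carry this over to profinite-C groups: [A], the closure of [G'],
    is abelian, and so is any complement [B] of [A].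

    In an abelian normal subgroup every closed subgroup then has a normal
    complement.  By Zorn's lemma and compactness there is a maximal independent
    family of normal subgroups [N] of prime index in [A]; it has trivial
    intersection, and the intersections of all its members but one are the
    factors [<a_i>].

    Conversely, if [A = Cr <a_i>], every closed subgroup of [A] is complemented
    by a subproduct (a minimal one that still generates [A] with it), which is
    normal in [G].  A closed [H] is complemented by [Z Y], where [Y] is such a
    complement of [H :&: A] in [A] and [Z] one of [B :&: H Y] in [B]. *)

(** * Finite groups in which every subgroup has a complement *)

Section FiniteComplemented.
Import GroupScope.
Variable gT : finGroupType.
Implicit Types A G H K N : {group gT}.

Definition complemented G := forall H, H \subset G -> [splits G, over H].

Lemma complementedS G H : H \subset G -> complemented G -> complemented H.
Proof.
move=> sHG cG L sLH; have /splitsP[K /complP[tiLK defG]] := cG L (subset_trans sLH sHG).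
apply/splitsP; exists (K :&: H); apply/complP; split.
  by rewrite setIA tiLK; apply/setIidPl; rewrite sub1G.
by rewrite group_modl // defG; apply/setIidPr.
Qed.

(* [H] fixes the coset [H], so its other orbits on the cosets of [H] have fewer than [pdiv #|G|] points; their sizes divide [#|G|], hence are 1. *)
Lemma index_pdiv_normal G H : H \subset G -> #|G : H| = pdiv #|G| -> H <| G.
Proof.
move=> sHG iHG; rewrite /normal sHG /=.
have HT : (H : {set gT}) \in rcosets H G.
  by rewrite -[X in X \in _]mulg1 -rcosetE; apply: imset_f.
suffices fixH x : x \in rcosets H G -> orbit 'Rs H x = [set x].
  have sHC : H \subset gcore H G.
    apply/subsetP=> h Hh; rewrite -astabRs_rcosets; apply/astabP=> x /fixH ox.
    by apply/set1P; rewrite -ox mem_orbit.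
  have <- : gcore H G = H by apply/eqP; rewrite eqEsubset gcore_sub.
  exact: gcore_norm.
move=> Gx; apply: card_orbit1.
have [-> | neHx] := eqVneq x H; first by rewrite card_orbit astab1Rs setIid indexgg.
have sO : orbit 'Rs H x \subset rcosets H G :\ (H : {set gT}).
  rewrite subsetD1 acts_sub_orbit //; last first.
    exact: subset_trans sHG (atrans_acts (transRs_rcosets H G)).
  rewrite Gx; apply: contra neHx => /orbitP[h Hh /=]; rewrite rcosetE => defH.
  by rewrite -(rcosetK h x) defH rcoset_id ?groupV.
have ltO : #|orbit 'Rs H x| < pdiv #|G|.
  rewrite -iHG /indexg; apply: leq_ltn_trans (subset_leq_card sO) _.
  by rewrite [in X in _ < X](cardsD1 (H : {set gT})) HT.
have dO : #|orbit 'Rs H x| %| #|G| := dvdn_trans (dvdn_orbit _ _ _) (cardSg sHG).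
apply/eqP; rewrite eqn_leq card_gt0; apply/andP; split.
  by rewrite leqNgt; apply/negP=> O1; move: ltO; rewrite ltnNge pdiv_min_dvd.
by apply/set0Pn; exists x; apply: orbit_refl.
Qed.

Lemma complemented_solvable G : complemented G -> solvable G.
Proof.
have [n] := ubnP #|G|; elim: n G => // n IHn G /ltnSE leGn cG.
have [-> | ntG] := eqVneq G 1%G; first exact: solvable1.
have p_pr : prime (pdiv #|G|) by rewrite pdiv_prime // cardG_gt1.
have [x Gx ox] := Cauchy p_pr (pdiv_dvd _).
have /splitsP[K /complP[tiK defG]] := cG <[x]>%G (eq_ind _ is_true Gx _ (esym (cycle_subG x G))).
have sKG : K \subset G by rewrite -defG mulG_subr.
have oG : #|G| = (pdiv #|G| * #|K|)%N by rewrite -{1}ox -TI_cardMg // defG.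
have iK : #|G : K| = pdiv #|G|.
  by apply/eqP; rewrite -(eqn_pmul2l (cardG_gt0 K)) Lagrange // {1}oG mulnC.
have nKG := index_pdiv_normal sKG iK.
have solK : solvable K.
  apply: IHn (complementedS sKG cG); apply: leq_trans leGn.
  by rewrite oG ltn_Pmull ?prime_gt1.
rewrite (series_sol nKG) solK.
apply: abelian_sol; apply: cyclic_abelian; apply: prime_cyclic.
by rewrite card_quotient ?normal_norm // iK.
Qed.

(** If [K] complements [H] in [G], take [N = K :&: A]. It is normalized by [H] because [A] is
    abelian and by [K] because [A] is normal, hence by [G = H * K]. *)
Lemma complemented_normal_split G A H :
    complemented G -> A <| G -> abelian A -> H \subset A ->
  exists2 N : {group gT}, N <| G & (H * N = A) /\ H :&: N = 1.
Proof.
move=> cG nAG abA sHA.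
have /splitsP[K /complP[tiK defG]] := cG H (subset_trans sHA (normal_sub nAG)).
exists (K :&: A)%G; last first.
  rewrite /= group_modl // defG setIA tiK; split.
    by apply/setIidPr; rewrite normal_sub.
  by apply/setIidPl; rewrite sub1G.
have sKG : K \subset G by rewrite -defG mulG_subr.
rewrite /normal subIset ?sKG //= -defG mul_subG //.
  rewrite (subset_trans sHA) // cents_norm //.
  by rewrite (subset_trans abA) // centS ?subsetIr.
by rewrite normsI ?normG // (subset_trans sKG) ?normal_norm.
Qed.

(** A cyclic group has an abelian automorphism group, so the conjugation action of [G] on [N] kills
    the derived subgroup. *)
Lemma der1_cent_cyclic G N : N <| G -> cyclic N -> N \subset 'C(G^`(1)).
Proof.
move=> nNG cN; rewrite centsC -ker_conj_aut ker_trivg_morphim.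
have nNG' := normal_norm nNG.
rewrite (subset_trans (der_sub 1 G)) //= morphim_der //; apply/trivgP/derG1P.
exact: abelianS (Aut_conj_aut _ _) (Aut_cyclic_abelian cN).
Qed.

Lemma complemented_der1_cent G A :
  complemented G -> A <| G -> abelian A -> A \subset 'C(G^`(1)).
Proof.
move=> cG nAG abA.
have sAG := normal_sub nAG; have nGA := normal_norm nAG.
have [N nNG [defA tiN]] := complemented_normal_split cG nAG abA (subsetIl A 'C(G^`(1))).
suffices N1 : N :=: 1 by rewrite -defA N1 mulg1 subsetIr.
apply/eqP/idPn => ntN.
have sNA : N \subset A by rewrite -defA mulG_subr.
have [M minM sMN] := minnormal_exists ntN (normal_norm nNG).
have /andP[ntM nMG] := mingroupp minM.
have sMA := subset_trans sMN sNA.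
have nnMG : M <| G by rewrite /normal nMG (subset_trans sMA).
have [x Mx ntx] := trivgPn _ ntM.
have sxM : <[x]> \subset M by rewrite cycle_subG.
have [L nLG [defM tiL]] := complemented_normal_split cG nnMG (abelianS sMA abA) sxM.
have L1 : L :=: 1.
  apply/eqP/idPn => ntL.
  have /mingroupP[_ /(_ L)] := minM; rewrite ntL (normal_norm nLG) => /(_ isT).
  have sLM : L \subset M by rewrite -defM mulG_subr.
  move/(_ sLM) => eLM; move: tiL ntx; rewrite eLM (setIidPl sxM) => /eqP.
  by rewrite cycle_eq1 => /eqP ->; rewrite eqxx.
have cM : cyclic M by rewrite -defM L1 mulg1 cycle_cyclic.
have : x \in (1%g : {set gT}).
  rewrite -tiN inE (subsetP sMN) // inE (subsetP sMA) // andbT.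
  exact: (subsetP (der1_cent_cyclic nnMG cM)).
by rewrite inE (negPf ntx).
Qed.

Lemma complemented_der1_abelian G : complemented G -> abelian G^`(1).
Proof.
move=> cG.
have [A /maxgroupP[/andP[nAG abA] maxA] _] :
    {A : {group gT} | [max A | (A <| G) && abelian A] & 1%G \subset A}.
  by apply: maxgroup_exists; rewrite normal1 abelian1.
have sAG := normal_sub nAG; have nGA := normal_norm nAG.
have sG'C : G^`(1) \subset 'C_G(A).
  by rewrite subsetI der_sub centsC complemented_der1_cent.
(* Let [K] complement [A]. If ['C_K(A)] is nontrivial, it contains a minimal [K]-normalized subgroup
   [M], abelian by solvability. Then [A <*> M] is abelian and normal, so maximality puts [M] inside
   [A], which meets [K] trivially. *)
suffices CA : 'C_G(A) \subset A by apply: abelianS abA; apply: subset_trans sG'C CA.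
have /splitsP[K /complP[tiAK defG]] := cG A sAG.
have sKG : K \subset G by rewrite -defG mulG_subr.
have nCK : K \subset 'N('C_K(A)).
  by rewrite normsI ?normG // norms_cent // (subset_trans sKG).
have defC : A * 'C_K(A) = 'C_G(A) by rewrite group_modl // defG.
have [C1 | ntC] := eqVneq 'C_K(A) 1; first by rewrite -defC C1 mulg1.
have [M minM sMC] := minnormal_exists ntC nCK.
have sMK : M \subset K := subset_trans sMC (subsetIl _ _).
have [nMK ntM abM] := minnormal_solvable minM sMK
  (complemented_solvable (complementedS sKG cG)).
have cMA : M \subset 'C(A) := subset_trans sMC (subsetIr _ _).
have abAM : abelian (A <*> M) by rewrite abelianY abA (abelem_abelian abM).
have nAMG : A <*> M <| G.
  rewrite /normal join_subG sAG (subset_trans sMK) //=.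
  rewrite -defG mul_subG //; first by rewrite (subset_trans (joing_subl A M)) ?normG.
  by rewrite normsY // (subset_trans sKG).
have /= := maxA (A <*> M)%G; rewrite nAMG abAM => /(_ isT (joing_subl _ _)) eAM.
have sMA : M \subset A by rewrite -eAM joing_subr.
by case/negP: ntM; rewrite -subG1 -tiAK subsetI sMA.
Qed.
End FiniteComplemented.

(* Compactness, and clopen sets in totally disconnected compact spaces *)
From mathcomp Require Import boolp classical_sets functions cardinality filter topology.

Local Open Scope classical_set_scope.
Local Open Scope group_scope.

(** The sets [Q k] form a base of a proper filter; a cluster point of it lies in each of them, as
    they are closed. In this form compactness serves for the chains in Zorn's lemma. *)
Lemma directed_meet (T : topologicalType) (K : Type) (F : set K) (Q : K -> set T) :
    compact [set: T] -> F !=set0 ->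
    (forall k, F k -> closed (Q k)) -> (forall k, F k -> Q k !=set0) ->
    (forall k l, F k -> F l -> exists2 m, F m & Q m `<=` Q k `&` Q l) ->
  exists z, forall k, F k -> Q k z.
Proof.
move=> cT F0 clQ Q0 dQ.
have fF : Filter (filter_from F Q) by apply: filter_from_filter.
have pF : ProperFilter (filter_from F Q) by apply: filter_from_proper.
have [z [_ cz]] := cT _ pF filterT.
exists z => k Fk; apply: clQ => // B nB.
by apply: cz => //; exists k.
Qed.

(** In a compact Hausdorff space the intersection [Q] of all clopen sets around [x] is connected, so
    total disconnectedness shrinks it to [x]. *)
Lemma totally_disconnected_zero_dimensional (T : topologicalType) :
    hausdorff_space T -> compact [set: T] -> totally_disconnected [set: T] ->
  zero_dimensional T.
Proof.
move=> hT cT tdT x y xNy; apply: contrapT => noU.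
pose C := [set D : set T | clopen D /\ D x].
pose Q := \bigcap_(D in C) D.
have Qx : Q x by move=> D [].
have Qy : Q y.
  by move=> D [cD Dx]; apply: contrapT => nDy; apply: noU; exists D.
have clQ : closed Q by apply: closed_bigI => D [[]].
have CT : C setT by split => //; exact: clopenT.
(* By compactness, a closed set that misses [Q] already misses one of the clopen sets. *)
have sepQ (Z : set T) : closed Z -> Z `&` Q = set0 -> exists2 D, C D & D `&` Z = set0.
  move=> clZ ZQ; apply: contrapT => noD.
  have [||k Ck|k l [ck kx] [cl lx]|z zP] :=
      @directed_meet T _ C (fun D => D `&` Z) cT.
  - by exists setT.
  - by move=> k [[_ clk] _]; exact: closedI.
  - by apply/set0P/negP => /eqP kZ; apply: noD; exists k.
  - exists (k `&` l); first by split => //; exact: clopenI.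
    by move=> t [[]].
  - have : set0 z by rewrite -ZQ; split => [|D CD]; [case: (zP _ CT)|case: (zP _ CD)].
    by [].
suff cQ : connected Q.
  have : connected_component [set: T] x y by exists Q.
  by rewrite tdT // => /esym/eqP; rewrite (negPf xNy).
apply/connectedP => E [E0 EQ sE].
wlog Ex : E E0 EQ sE / E false x.
  move=> wE; have : Q x by []. rewrite EQ => -[Ex|Ex]; first exact: (wE E).
  apply: (wE (fun b => E (~~ b))) => //=; first by rewrite setUC.
  by rewrite separatedC.
have clE b : closed (E b).
  move=> z cz; have : Q z by apply: clQ; move: z cz; apply: closureS => z Ez;
    rewrite EQ; case: b Ez; [right|left].
  case: sE => s1 s2; rewrite EQ; case: b cz => cz [] // Ez.
  - by exfalso; suff : set0 z by []; rewrite -s2.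
  - by exfalso; suff : set0 z by []; rewrite -s1.
have nE : set_nbhs (E false) (~` E true).
  move=> z Ez; apply: open_nbhs_nbhs; split; first by rewrite openC.
  by move=> Ez'; have := separated_disjoint sE; apply/eqP/set0P; exists z.
have [U nU UE] := compact_normal hT cT (clE false) nE.
(* The boundary of [U] misses [Q], so some clopen [D] around [x] misses it too. Then [D] cuts [U] in
   a clopen set, which contains [x] and hence [Q], although it avoids [E true]. *)
have [D [[oD clD] Dx] DU] : exists2 D, C D & D `&` (closure U `\` U°) = set0.
  apply: sepQ.
    by apply: closedI; [exact: closed_closure|apply: open_closedC; exact: open_interior].
  apply/seteqP; split => // z [[Uz nUz]]; rewrite EQ => -[Ez|Ez].
  - by apply: nUz; apply: nU.
  - exact: (UE z).
have eDU : D `&` U° = D `&` closure U.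
  apply/seteqP; split => z [Dz Uz]; split => //.
    by apply: subset_closure; exact: interior_subset.
  apply: contrapT => nUz; suff : set0 z by []. by rewrite -DU.
have [z Ez] := E0 true.
have Qz : Q z by rewrite EQ; right.
suff : (D `&` U°) z by rewrite eDU => -[_ /UE].
apply: Qz; split; last by split => //; exact: nU.
split; first by apply: openI => //; exact: open_interior.
by rewrite eDU; apply: closedI => //; exact: closed_closure.
Qed.

(** * Subgroups, stability under conjugation, and elements of prime order *)

Section Subgroups.
Variable G : topGroupType.
Implicit Types (x y : G) (H K A : set G).

(** For a subgroup [H], [W := setT] gives normality in [G] and [W := set0] gives no condition, so
    one statement can serve for both factors [A] and [B]. *)
Definition conj_stable (W H : set G) := forall w h, W w -> H h -> H (w^-1 * h * w).

Lemma subgroup1 H : is_subgroup H -> H 1. Proof. by case. Qed.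

Lemma subgroupM H x y : is_subgroup H -> H x -> H y -> H (x * y).
Proof. by case=> _ [+ _]; apply. Qed.

Lemma subgroupV H x : is_subgroup H -> H x -> H x^-1.
Proof. by case=> _ [_]; apply. Qed.

Lemma subgroupX H x n : is_subgroup H -> H x -> H (x ^+ n).
Proof.
move=> sH Hx; elim: n => [|n IHn]; first exact: subgroup1.
by rewrite expgS; exact: subgroupM.
Qed.

Lemma subgroupI H K : is_subgroup H -> is_subgroup K -> is_subgroup (H `&` K).
Proof.
move=> sH sK; split; first by split; exact: subgroup1.
split=> [x y [Hx Kx] [Hy Ky]|x [Hx Kx]]; first by split; exact: subgroupM.
by split; exact: subgroupV.
Qed.

Lemma closed_subgroupI H K :
  closed_subgroup H -> closed_subgroup K -> closed_subgroup (H `&` K).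
Proof. by move=> [sH cH] [sK cK]; split; [exact: subgroupI|exact: closedI]. Qed.

Lemma subgroup_bigcap I (P : set I) (N : I -> set G) :
  (forall i, P i -> is_subgroup (N i)) -> is_subgroup (\bigcap_(i in P) N i).
Proof.
move=> sN; split; first by move=> i /sN /subgroup1.
split=> [x y Nx Ny i Pi|x Nx i Pi]; first by apply: subgroupM; [exact: sN|exact: Nx|exact: Ny].
by apply: subgroupV; [exact: sN|exact: Nx].
Qed.

Lemma closed_subgroup_bigcap I (P : set I) (N : I -> set G) :
  (forall i, P i -> closed_subgroup (N i)) -> closed_subgroup (\bigcap_(i in P) N i).
Proof.
move=> sN; split; first by apply: subgroup_bigcap => i /sN [].
by apply: closed_bigI => i /sN [].
Qed.

Lemma subgroup_divr H x y : is_subgroup H -> H x -> H (x * y) -> H y.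
Proof. by move=> sH Hx Hxy; rewrite -(mulKg x y); apply: subgroupM => //; exact: subgroupV. Qed.

Lemma subgroup_divl H x y : is_subgroup H -> H y -> H (x * y) -> H x.
Proof. by move=> sH Hx Hxy; rewrite -(mulgK y x); apply: subgroupM => //; exact: subgroupV. Qed.

Lemma setmul_subgroup H K :
  is_subgroup H -> is_subgroup K -> conj_stable H K -> is_subgroup (setmul H K).
Proof.
move=> sH sK HK; split; first by exists 1, 1; rewrite mulg1; split; [|split]; rewrite //; exact: subgroup1.
split=> [_ _ [h [k [Hh [Kk ->]]]] [h' [k' [Hh' [Kk' ->]]]]|_ [h [k [Hh [Kk ->]]]]].
  exists (h * h'), ((h'^-1 * k * h') * k'); split; first exact: subgroupM.
  by split; [apply: subgroupM => //; exact: HK|rewrite !mulgA mulgK].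
exists h^-1, (h * k^-1 * h^-1); split; first exact: subgroupV.
split; last by rewrite invgM !mulgA mulVg mul1g.
by rewrite -{1}(invgK h); apply: HK; exact: subgroupV.
Qed.

Lemma gen_subgroup (S : set G) : is_subgroup (gen S).
Proof.
split; first by move=> H /subgroup1.
split=> [x y gx gy H sH SH|x gx H sH SH].
  by apply: subgroupM => //; [exact: gx|exact: gy].
by apply: subgroupV => //; exact: gx.
Qed.

Lemma mem_gen_set (S : set G) : S `<=` gen S.
Proof. by move=> x Sx H _; exact. Qed.

Lemma gen_min (S H : set G) : is_subgroup H -> S `<=` H -> gen S `<=` H.
Proof. by move=> sH SH x; apply. Qed.

Lemma preim_conj_subgroup H w : is_subgroup H -> is_subgroup [set h | H (w^-1 * h * w)].
Proof.
move=> sH; split; first by rewrite /= mulg1 mulVg; exact: subgroup1.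
split=> [x y /= Hx Hy|x /= Hx].
  have -> : w^-1 * (x * y) * w = (w^-1 * x * w) * (w^-1 * y * w) by rewrite !mulgA mulgK.
  exact: subgroupM.
have -> : w^-1 * x^-1 * w = (w^-1 * x * w)^-1 by rewrite !invgM invgK mulgA.
exact: subgroupV.
Qed.

Lemma conj_stable_gen (W S : set G) : conj_stable W S -> conj_stable W (gen S).
Proof.
move=> WS w h Ww; move: h; apply: gen_min; first by apply: preim_conj_subgroup; exact: gen_subgroup.
by move=> h Sh /=; apply: mem_gen_set; exact: WS.
Qed.

Lemma conj_stable_bigcup I (P : set I) (W : set G) (N : I -> set G) :
  (forall i, P i -> conj_stable W (N i)) -> conj_stable W (\bigcup_(i in P) N i).
Proof. by move=> WN w h Ww [i Pi Nh]; exists i => //; exact: WN. Qed.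

Lemma conj_stable_bigcap I (P : set I) (W : set G) (N : I -> set G) :
  (forall i, P i -> conj_stable W (N i)) -> conj_stable W (\bigcap_(i in P) N i).
Proof. by move=> WN w h Ww Nh i Pi; apply: WN => //; exact: Nh. Qed.

Lemma conj_stableI (W H K : set G) :
  conj_stable W H -> conj_stable W K -> conj_stable W (H `&` K).
Proof. by move=> WH WK w h Ww [Hh Kh]; split; [exact: WH|exact: WK]. Qed.

Lemma subgroup_conj_stable H : is_subgroup H -> conj_stable H H.
Proof. by move=> sH w h Hw Hh; apply: subgroupM => //; apply: subgroupM => //; exact: subgroupV. Qed.

Lemma cyc_id x : cyc x x. Proof. exact: mem_gen_set. Qed.
Arguments cyc_id x : clear implicits.

Lemma cyc_subgroup x : is_subgroup (cyc x). Proof. exact: gen_subgroup. Qed.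

Lemma cyc_min x H : is_subgroup H -> H x -> cyc x `<=` H.
Proof. by move=> sH Hx; apply: gen_min => // _ ->. Qed.

Lemma cycP x y : prime_order x -> cyc x y <-> exists k, y = x ^+ k.
Proof.
move=> [p [p_pr [p0 [xp _]]]]; split=> [|[k ->]]; last by exact: (subgroupX k (cyc_subgroup x) (cyc_id x)).
apply: (@cyc_min x [set y | exists k, y = x ^+ k]); last by exists 1%N.
split; first by exists 0%N.
split=> [_ _ [k ->] [l ->]|_ [k ->]]; first by exists (k + l)%N; rewrite expgnDr.
(* Since [x ^+ p = 1], the inverse of [x ^+ k] is its power with exponent [p.-1]; powers by natural
   numbers thus suffice. *)
exists (k * p.-1)%N; apply: (mulgI (x ^+ k)); rewrite mulgV -expgnDr.
by rewrite -mulnS prednK // mulnC expgnA xp expg1n.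
Qed.

Lemma expg_modn_order x n k : x ^+ n = 1 -> x ^+ k = x ^+ (k %% n).
Proof. by move=> xn; rewrite {1}(divn_eq k n) expgnDr mulnC expgnA xn expg1n mul1g. Qed.

Lemma prime_order_expK x k : prime_order x -> x ^+ k <> 1 -> exists m, x ^+ k ^+ m = x.
Proof.
move=> [p [p_pr [p0 [xp minp]]]] xk.
have cop : coprime k p.
  rewrite coprime_sym prime_coprime //; apply/negP => /dvdnP[q kE].
  by apply: xk; rewrite kE mulnC expgnA xp expg1n.
have k0 : (0 < k)%N by case: k xk {cop}.
(* The Bezout coefficient [a] inverts [k] modulo [p]. *)
have [a b e _] := egcdnP p k0.
exists a; rewrite -expgnA mulnC e (eqP cop) expgnDr mulnC expgnA xp expg1n mul1g.
by rewrite expg1.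
Qed.

Lemma prime_order_neq1 x : prime_order x -> x <> 1.
Proof. by move=> [p [p_pr [_ [_ minp]]]]; have := minp 1%N isT (prime_gt1 p_pr). Qed.

Lemma prime_orderP x p : prime p -> x ^+ p = 1 -> x <> 1 -> prime_order x.
Proof.
move=> p_pr xp x1; exists p; split => //; split; first exact: prime_gt0.
split => // m m0 mp xm; apply: x1.
have cop : coprime p m by rewrite prime_coprime // gtnNdvd.
have [a b e _] := egcdnP p m0.
have : x ^+ (a * m) = 1 by rewrite mulnC expgnA xm expg1n.
by rewrite e gcdnC (eqP cop) expgnDr mulnC expgnA xp expg1n mul1g expg1.
Qed.

(** For a prime [p] dividing [n], either [x ^+ (n %/ p)] has order [p], or it is [1] and the smaller
    exponent takes the place of [n]. *)
Lemma finite_order_prime x n : (0 < n)%N -> x ^+ n = 1 -> x <> 1 ->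
  exists k, prime_order (x ^+ k).
Proof.
elim/ltn_ind: n => n IHn n0 xn x1.
have n1 : (1 < n)%N by case: n n0 xn {IHn} => [|[|n]] // _; rewrite expg1.
have p_pr := pdiv_prime n1; set p := pdiv n in p_pr.
have nE : n = (n %/ p * p)%N by rewrite divnK // pdiv_dvd.
have [xq|xq] := pselect (x ^+ (n %/ p) = 1).
  apply: (IHn (n %/ p)%N) => //; first by rewrite ltn_Pdiv // prime_gt1.
  by rewrite divn_gt0 ?prime_gt0 // dvdn_leq // pdiv_dvd.
by exists (n %/ p)%N; apply: (prime_orderP p_pr) => //; rewrite -expgnA -nE.
Qed.

End Subgroups.

(** * Topology of profinite groups: closures, open subgroups and their cosets *)

Section Profinite.
Variables (G : topGroupType) (hG : profinite G).
Implicit Types (x y : G) (H K A U : set G).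

Let cM : continuous (fun p : G * G => p.1 * p.2). Proof. by case: hG. Qed.
Let cV : continuous (fun x : G => x^-1). Proof. by case: hG => _ []. Qed.
Let hausG : hausdorff_space G. Proof. by case: hG => _ [_ []]. Qed.
Let cptG : compact [set: G]. Proof. by case: hG => _ [_ [_ []]]. Qed.

Lemma continuous_mull a : continuous (fun x : G => a * x).
Proof.
move=> x; apply: (@continuous_comp _ _ _ (fun x => (a, x)) (fun p : G * G => p.1 * p.2)).
  by apply: cvg_pair; [exact: cvg_cst|exact: cvg_id].
exact: cM.
Qed.

Lemma continuous_mulr a : continuous (fun x : G => x * a).
Proof.
move=> x; apply: (@continuous_comp _ _ _ (fun x => (x, a)) (fun p : G * G => p.1 * p.2)).
  by apply: cvg_pair; [exact: cvg_id|exact: cvg_cst].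
exact: cM.
Qed.

Lemma continuous_conj a : continuous (fun x : G => a^-1 * x * a).
Proof.
move=> x; apply: (@continuous_comp _ _ _ (fun x => a^-1 * x) (fun x => x * a)).
  exact: continuous_mull.
exact: continuous_mulr.
Qed.

Lemma closed_preim (f : G -> G) H : continuous f -> closed H -> closed [set x | H (f x)].
Proof. by move=> /continuous_closedP; apply. Qed.

Lemma closed1 : closed [set 1 : G].
Proof. by apply: compact_closed => //; exact: compact_set1. Qed.

Lemma closed_setmul H K : closed H -> closed K -> closed (setmul H K).
Proof.
move=> cH cK; apply: compact_closed => //.
have -> : setmul H K = (fun p : G * G => p.1 * p.2) @` (H `*` K).
  apply/seteqP; split => [_ [h [k [Hh [Kk ->]]]]|_ [[h k] /= [Hh Kk] <-]].
    by exists (h, k).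
  by exists h, k.
apply: continuous_compact; first exact: continuous_subspaceT.
by apply: compact_setX; apply: (subclosed_compact _ cptG).
Qed.

Lemma closed_cyc x : prime_order x -> closed (cyc x).
Proof.
move=> px; have [p [p_pr [p0 [xp _]]]] := px.
apply: compact_closed => //; apply: finite_compact.
have -> : cyc x = (fun i : 'I_p => x ^+ i) @` [set: 'I_p].
  apply/seteqP; split=> [y /(cycP _ px)[k ->]|_ [i _ <-]]; last by apply/(cycP _ px); exists i.
  by exists (Ordinal (ltn_pmod k p0)) => //=; rewrite -expg_modn_order.
exact: finite_image.
Qed.

Lemma closure_min H K : closed K -> H `<=` K -> closure H `<=` K.
Proof. by move=> cK /closureS; rewrite -((closure_id K).1 cK). Qed.

Lemma closure_subgroup H : is_subgroup H -> is_subgroup (closure H).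
Proof.
move=> sH; have clH : closed (closure H) by exact: closed_closure.
split; first by apply: subset_closure; exact: subgroup1.
have HM x y : H x -> closure H y -> closure H (x * y).
  move=> Hx; move: y; apply: closure_min => [|y Hy].
    by apply: closed_preim => //; exact: continuous_mull.
  by apply: subset_closure; exact: subgroupM.
split=> [x y cx cy|]; last first.
  apply: closure_min => [|x Hx]; first by apply: closed_preim => //; exact: cV.
  by apply: subset_closure; exact: subgroupV.
move: x cx; apply: closure_min => [|x Hx]; last exact: HM.
by apply: (@closed_preim (fun x => x * y)) => //; exact: continuous_mulr.
Qed.

Lemma closure_closed_subgroup H : is_subgroup H -> closed_subgroup (closure H).
Proof. by move=> sH; split; [exact: closure_subgroup|exact: closed_closure]. Qed.

Lemma conj_stable_closure W H : conj_stable W H -> conj_stable W (closure H).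
Proof.
move=> WH w h Ww; move: h; apply: closure_min => [|h Hh].
  by apply: closed_preim; [exact: continuous_conj|exact: closed_closure].
by apply: subset_closure; exact: WH.
Qed.

(** Centralizers are closed, being preimages of [1] under a commutator map; so commutation passes to
    the closure in one variable at a time. *)
Lemma closure_commute H : (forall x y, H x -> H y -> x * y = y * x) ->
  forall x y, closure H x -> closure H y -> x * y = y * x.
Proof.
move=> cH; have clC y : closed [set x | x * y = y * x].
  have -> : [set x | x * y = y * x] = [set x | [set 1] (x^-1 * (y^-1 * x * y))].
    apply/seteqP; split=> x /=; first by move=> e; rewrite -!mulgA e mulKg mulVg.
    by move=> e; apply: (mulgI y^-1); apply: (mulgI x^-1); rewrite mulKg mulVg -e !mulgA.
  apply: (@closed_preim (fun x => x^-1 * (y^-1 * x * y))) closed1 => x.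
  apply: (@continuous_comp _ _ _ (fun x => (x^-1, y^-1 * x * y)) (fun p : G * G => p.1 * p.2)).
    by apply: cvg_pair; [exact: cV|exact: continuous_conj].
  exact: cM.
have clH x y : H x -> closure H y -> x * y = y * x.
  move=> Hx cy; apply/esym; move: y cy; apply: closure_min; first exact: clC.
  by move=> y Hy; exact: cH.
move=> x y cx cy; move: x cx; apply: closure_min; first exact: clC.
by move=> x Hx; exact: clH.
Qed.

Lemma nbhs_mulr U x : nbhs 1 U -> nbhs x [set y | U (x^-1 * y)].
Proof. by move=> nU; apply: (@continuous_mull x^-1 x); rewrite mulVg. Qed.

Lemma open_subgroup_closed U : is_subgroup U -> nbhs 1 U -> closed U.
Proof.
move=> sU nU x /(_ _ (nbhs_mulr x nU)) [y [Uy /= Uxy]].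
rewrite -(invgK x); apply: subgroupV => //.
exact: (subgroup_divl sU Uy).
Qed.

Lemma open_subgroup_open U : is_subgroup U -> nbhs 1 U -> open U.
Proof.
move=> sU nU; rewrite openE => x Ux; apply: filterS (nbhs_mulr x nU) => y /= Uxy.
by rewrite -(mulKVg x y); exact: subgroupM.
Qed.

(** Choose a clopen [D] inside [V] around [1]. The elements whose right translations, and those of
    their inverses, map [D] into itself form a subgroup; it is a neighbourhood of [1] because [D] is
    compact and open, and it lies in [D] because [1] does. *)
Lemma open_subgroup_exists (V : set G) : nbhs 1 V ->
  exists U, [/\ is_subgroup U, nbhs 1 U & U `<=` V].
Proof.
move=> nV.
have zG : zero_dimensional G.
  by apply: totally_disconnected_zero_dimensional => //; case: hG => _ [_ [_ []]].
have [D [D1 [oD cD]] DV] := zero_dimensional_cvg hausG zG cptG nV.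
have /compact_near_coveringP ncD : compact D by exact: subclosed_compact cptG _.
have nD u : D u -> \forall v \near u & w \near 1, D (v * w).
  move=> Du; apply: (@cM (u, 1)) => /=; rewrite mulg1.
  exact: open_nbhs_nbhs.
pose U := [set u | forall v, D v -> D (v * u) /\ D (v * u^-1)].
have nU : nbhs 1 U.
  have n1 : \forall w \near (1 : G), D `<=` (fun v => D (v * w)) by exact: ncD.
  have n2 : \forall w \near (1 : G), D `<=` (fun v => D (v * w^-1)).
    by apply: (@cV 1 [set w | D `<=` (fun v => D (v * w))]); rewrite /= invg1.
  apply: filterS2 n1 n2 => w w1 w2 v Dv; split; [exact: w1|exact: w2].
exists U; split => //; last by move=> u /(_ _ D1)[]; rewrite mul1g => /DV.
split; first by move=> v; rewrite invg1 !mulg1.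
split=> [x y Ux Uy v Dv|x Ux v Dv]; last by rewrite invgK; have [] := Ux v Dv.
rewrite invgM !mulgA; split; first by apply: (Uy _ _).1; apply: (Ux _ _).1.
by apply: (Ux _ _).2; apply: (Uy _ _).2.
Qed.

Lemma separate_subgroup x : x <> 1 -> exists U, [/\ is_subgroup U, nbhs 1 U & ~ U x].
Proof.
move=> x1; have nV : nbhs (1 : G) (~` [set x]).
  apply: open_nbhs_nbhs; split; last by move=> /esym.
  by rewrite openC; apply: compact_closed => //; exact: compact_set1.
have [U [sU nU UV]] := open_subgroup_exists nV.
by exists U; split=> // Ux; exact: (UV x Ux).
Qed.

(** Otherwise the complements of finite unions of cosets would have a common point by compactness,
    and this point would avoid its own coset. *)
Lemma finite_coset_cover U : is_subgroup U -> nbhs 1 U ->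
  exists s : seq G, forall x, exists2 z, z \in s & U (x * z^-1).
Proof.
move=> sU nU; apply: contrapT => nos.
pose Q (s : seq G) := \bigcap_(z in [set z | z \in s]) [set x | (~` U) (x * z^-1)].
have [||s _|s t _ _|x Qx] := @directed_meet G (seq G) setT Q cptG.
- by exists [::].
- move=> s _; apply: closed_bigI => z _; apply: closed_preim; first exact: continuous_mulr.
  by rewrite closedC; exact: open_subgroup_open.
- apply: contrapT => Qs; apply: nos; exists s => x; apply: contrapT => nz.
  by apply: Qs; exists x => z zs Ux; apply: nz; exists z.
- exists (s ++ t) => // x Qx; split=> z /= zs; apply: Qx => /=; by rewrite mem_cat zs ?orbT.
- by apply: (Qx [:: x] I x) => /=; rewrite ?inE // mulgV; exact: subgroup1.
Qed.

(** The number [r x] is the position of the first entry of a covering list that lies in the right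
    coset of [x], and [t] reads off the entry. The list may repeat cosets, so [r (t i) = i] is only
    claimed for [i] of the form [r x]. *)
Lemma finite_cosets U : is_subgroup U -> nbhs 1 U ->
  exists n (r : G -> 'I_n) (t : 'I_n -> G),
    (forall x y, r x = r y <-> U (x * y^-1)) /\ (forall x, r (t (r x)) = r x).
Proof.
move=> sU nU; have [s sP] := finite_coset_cover sU nU.
pose f x := find (fun z => `[< U (x * z^-1) >]) s.
have fs x : has (fun z => `[< U (x * z^-1) >]) s.
  by have [z zs Ux] := sP x; apply/hasP; exists z => //; apply/asboolP.
have lf x : (f x < size s)%N by rewrite -has_find.
have Uf x : U (x * (nth 1 s (f x))^-1) by apply/asboolP; exact: (nth_find 1 (fs x)).
have fE x y : U (x * y^-1) -> f x = f y.
  move=> Uxy; apply: eq_find => z; apply/asboolP/asboolP => Uz.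
    by apply: (subgroup_divr sU Uxy); rewrite !mulgA mulgVK.
  by rewrite -(mulgVK y x) -mulgA; exact: subgroupM.
exists (size s), (fun x => Ordinal (lf x)), (fun i => nth 1 s i).
split=> [x y|x].
  split=> [/(congr1 val) /= fxy|/fE fxy]; last exact/val_inj.
  have Ux := Uf x; have := subgroupV sU (Uf y); rewrite -fxy invgM invgK => Uy.
  by have := subgroupM sU Ux Uy; rewrite !mulgA mulgVK.
apply/val_inj => /=; apply/esym/fE; exact: Uf.
Qed.

(** Two of the first [n.+1] powers of [x] lie in one of the [n] cosets of [U]. Their quotient lies
    in both [H] and [U], so [x] has finite order. *)
Lemma exists_prime_order_of_discrete H U x : is_subgroup H -> is_subgroup U -> nbhs 1 U ->
  (forall y, H y -> U y -> y = 1) -> H x -> x <> 1 -> exists k, prime_order (x ^+ k).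
Proof.
move=> sH sU nU HU Hx x1; have [n [r [_ [rP _]]]] := finite_cosets sU nU.
have [i [j [ij rij]]] : exists i j : 'I_n.+1, (i < j)%N /\ r (x ^+ i) = r (x ^+ j).
  have : ~~ injectiveb (fun i : 'I_n.+1 => r (x ^+ i)).
    by apply/negP => /injectiveP /leq_card; rewrite !card_ord ltnn.
  move=> /injectivePn[i [j ij rij]].
  have [lt|lt|e] := ltngtP i j; [by exists i, j|by exists j, i|].
  by move/eqP: ij; case; exact: val_inj.
apply: (@finite_order_prime _ x (j - i)) => //; first by rewrite subn_gt0.
apply: HU; first exact: subgroupX.
move/esym/rP: rij; rewrite -[in X in X -> _](subnK (ltnW ij)) expgnDr mulgK.
by [].
Qed.

End Profinite.

(** * Finite images of profinite groups, and coset actions *)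

Section FiniteImages.
Variables (G : topGroupType) (gT : finGroupType) (f : G -> gT).
Hypothesis fM : forall x y, f (x * y) = f x * f y.

Lemma fin_morph1 : f 1 = 1.
Proof. by apply: (mulgI (f 1)); rewrite -fM !mulg1. Qed.

Lemma fin_morphV x : f x^-1 = (f x)^-1.
Proof. by apply: (mulgI (f x)); rewrite -fM !mulgV fin_morph1. Qed.

Lemma fin_image_group (K : set G) : is_subgroup K ->
  exists L : {group gT}, forall s, s \in L <-> exists2 g, K g & s = f g.
Proof.
move=> sK; pose L := finset (fun s => `[< exists2 g, K g & s = f g >]).
have LP s : reflect (exists2 g, K g & s = f g) (s \in L).
  by rewrite inE; exact: asboolP.
have gL : group_set L.
  apply/group_setP; split; first by apply/LP; exists 1; rewrite ?fin_morph1 //; exact: subgroup1.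
  move=> _ _ /LP[x Kx ->] /LP[y Ky ->]; apply/LP; exists (x * y) => //.
  exact: subgroupM.
by exists (group gL) => s; split => /LP.
Qed.

Lemma fin_preim_subgroup (L : {group gT}) : is_subgroup [set g | f g \in L].
Proof.
split; first by rewrite /= fin_morph1 group1.
split=> [x y /= Lx Ly|x /= Lx]; first by rewrite fM groupM.
by rewrite fin_morphV groupV.
Qed.

(** Pull a subgroup [H] of the image back to [G], complement it there, and map the complement [K]
    forward. An element of [K] with image in [H] lies in the pullback, so it is [1]. *)
Lemma fin_image_complemented (L : {group gT}) :
    (forall S : {set gT}, closed [set g | f g \in S]) -> profinite_C G ->
    (forall s, s \in L <-> exists2 g, [set: G] g & s = f g) ->
  complemented L.
Proof.
move=> cf cG LP H sHL.
have [|K [[sK _] [_ [HK tiHK]]]] := cG [set g | f g \in H].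
  by split; [exact: fin_preim_subgroup|exact: cf].
have [K' KP] := fin_image_group sK.
apply/splitsP; exists K'; apply/complP; split.
  apply/trivgP/fintype.subsetP => s /setIP[Hs /KP[g Kg sE]]; rewrite inE sE.
  have : [set (1 : G)] g by rewrite -tiHK; split => //=; rewrite -sE.
  by move=> ->; rewrite fin_morph1.
apply/eqP; rewrite finset.eqEsubset; apply/andP; split.
  rewrite mul_subG //; apply/fintype.subsetP => s /KP[g _ ->]; apply/LP; by exists g.
apply/fintype.subsetP => s /LP[g _ ->].
have : [set: G] g by [].
rewrite -HK => -[h [k [Hh [Kk ->]]]]; rewrite fM mem_mulg //.
by apply/KP; exists k.
Qed.

Lemma derived_image_commute (L : {group gT}) x y :
    (forall s, s \in L <-> exists2 g, [set: G] g & s = f g) ->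
    abelian L^`(1) -> derived x -> derived y -> f (x^-1 * (y^-1 * (x * y))) = 1.
Proof.
move=> LP abL.
have dL z : derived z -> f z \in L^`(1).
  move: z; apply: (@gen_min _ _ [set z | f z \in L^`(1)]); first exact: fin_preim_subgroup.
  move=> _ [u [v ->]] /=; rewrite !fM !fin_morphV -!mulgA.
  by apply: mem_commg; apply/LP; [exists u|exists v].
move=> /dL dx /dL dy; rewrite !fM !fin_morphV.
by apply/eqP/commgP; exact: (centsP abL).
Qed.

End FiniteImages.

Section Cosets.
Variables (G : topGroupType) (hG : profinite G) (U : set G).
Hypotheses (sU : is_subgroup U) (nU : nbhs 1 U).

(** The action is right translation of the right cosets of [U]. An element acting trivially fixes
    the coset of [1], so it lies in [U]. *)
Lemma coset_action : exists n (f : G -> {perm 'I_n}),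
  [/\ forall x y, f (x * y) = f x * f y, forall x, f x = 1 -> U x
    & forall S : {set {perm 'I_n}}, closed [set g | f g \in S]].
Proof.
have [n [r [t [rP rt]]]] := finite_cosets hG sU nU.
have rM x y g : r x = r y -> r (x * g) = r (y * g).
  by move=> /rP Uxy; apply/rP; rewrite invgM !mulgA mulgK.
(* A number with [r (t i) <> i] labels no coset; leaving it fixed keeps [f g] a permutation. *)
pose f g i := if r (t i) == i then r (t i * g) else i.
have f1 i : f 1 i = i by rewrite /f mulg1; case: eqP.
have fM x y i : f (x * y) i = f y (f x i).
  rewrite /f; case: (boolP (r (t i) == i)) => [_|/negPf ->] //.
  by rewrite rt eqxx mulgA; apply: rM; rewrite rt.
have fI g : injective (f g).
  by apply: (can_inj (g := f g^-1)) => i; rewrite -fM mulgV f1.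
exists n, (fun g => perm (fI g)); split.
- by move=> x y; apply/permP => i; rewrite permM !permE.
- move=> x /permP/(_ (r 1)); rewrite permE perm1 /f rt eqxx => e.
  suff /rP : r x = r 1 by rewrite invg1 mulg1.
  by rewrite -[in LHS](mul1g x) -[RHS]e; apply: rM; rewrite rt.
- move=> S p; set F := fun g => perm (fI g).
  (* Preimages under [F] are closed because [F] is locally constant; there are only finitely many
     [i] to control. *)
  suff nF : nbhs p [set g | F g = F p].
    by move=> /(_ _ nF)[g [/= Sg Fg]]; move: Sg; rewrite -/(F g) Fg.
  have : nbhs p (fun g => forall i, f g i = f p i).
    apply: filter_forall => i; rewrite /f; case: eqP => _; last exact: filterE.
    have cf : {for p, continuous (fun g => t i * g * (t i * p)^-1)}.
      apply: (@continuous_comp _ _ _ (fun g => t i * g) (fun g => g * (t i * p)^-1)).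
        exact: continuous_mull.
      exact: continuous_mulr.
    have : nbhs p [set g | U (t i * g * (t i * p)^-1)] by apply: cf; rewrite /= mulgV.
    by apply: filterS => g /rP.
  by apply: filterS => g e; apply/permP => i; rewrite !permE.
Qed.

End Cosets.

(** A nontrivial commutator of [x] and [y] would be missed by some open subgroup [U]. The finite
    image under the action on the cosets of [U] has abelian derived subgroup, so the commutator acts
    trivially and lies in [U] after all. *)
Lemma derived_commute (G : topGroupType) (x y : G) : profinite G -> profinite_C G ->
  derived x -> derived y -> x * y = y * x.
Proof.
move=> hG cG dx dy; apply: contrapT => nxy.
have [|U [sU nU]] := @separate_subgroup _ hG (x^-1 * (y^-1 * (x * y))).
  by move=> e; apply: nxy; apply: (mulgI y^-1); apply: (mulgI x^-1); rewrite e mulKg mulVg.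
have [n [f [fM fU cf]]] := coset_action hG sU nU.
have sT : is_subgroup [set: G] by [].
have [L LP] := fin_image_group fM sT.
apply; apply: fU; apply: (derived_image_commute fM LP) => //.
by apply: complemented_der1_abelian; exact: (fin_image_complemented fM cf).
Qed.

(** * Complements in cartesian products of groups of prime order *)

Section CartesianProducts.
Variables (G : topGroupType) (hG : profinite G).
Implicit Types (H K X W : set G).

Let cptG : compact [set: G]. Proof. by case: hG => _ [_ [_ []]]. Qed.

Lemma closed_subgroup_setmul H K :
  closed_subgroup H -> closed_subgroup K -> conj_stable H K -> closed_subgroup (setmul H K).
Proof.
by move=> [sH cH] [sK cK] HK; split; [exact: setmul_subgroup|exact: closed_setmul].
Qed.

Lemma sub_setmull H K : is_subgroup K -> H `<=` setmul H K.
Proof. by move=> sK h Hh; exists h, 1; rewrite mulg1; split=> //; split=> //; exact: subgroup1. Qed.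

Lemma sub_setmulr H K : is_subgroup H -> K `<=` setmul H K.
Proof. by move=> sH k Kk; exists 1, k; rewrite mul1g; split=> //; exact: subgroup1. Qed.

Section Independent.
Variables (I : Type) (x : I -> G) (N : I -> set G) (X : set G).
Hypotheses (cX : closed_subgroup X) (cN : forall i, closed_subgroup (N i)).
Hypotheses (XN : forall i, conj_stable X (N i)) (px : forall i, prime_order (x i)).
Hypotheses (Xx : forall i, X (x i)) (Nx : forall i j, j <> i -> N j (x i)).
Hypothesis splitN : forall i y, X y -> exists k n, N i n /\ y = x i ^+ k * n.
Hypothesis capN : forall y, X y -> (forall i, N i y) -> y = 1.

(* The closed subgroup of the elements whose components along [T] are trivial. *)
Let Y (T : set I) := X `&` \bigcap_(i in T) N i.

Let cY T : closed_subgroup (Y T).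
Proof. by apply: closed_subgroupI => //; exact: closed_subgroup_bigcap. Qed.

(** Dividing by the component along [i] keeps the components along [T] trivial, since [x i] lies in
    every [N j] with [j <> i]. *)
Let peel T i y : ~ T i -> Y T y ->
  exists k n, [/\ Y (T `|` [set i]) n, N i n & y = x i ^+ k * n].
Proof.
move=> nTi [Xy Ty]; have [k [n [Nn yE]]] := splitN i Xy.
exists k, n; split => //; split.
  by apply: (subgroup_divr (proj1 cX) (subgroupX k (proj1 cX) (Xx i))); rewrite -yE.
move=> j [Tj|-> //]; have ji : j <> i by move=> e; apply: nTi; rewrite -e.
have [sN _] := cN j.
by apply: (subgroup_divr sN (subgroupX k sN (Nx ji))); rewrite -yE; exact: Ty.
Qed.

(** Zorn's lemma gives a maximal [T] for which [H] and [Y T] still generate [X]. A nontrivial common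
    element of [H] and [Y T] would have a nontrivial component along some [i], and [T] could be
    enlarged by [i]. *)
Lemma independent_complement H : closed_subgroup H -> H `<=` X ->
  exists T : set I, X `<=` setmul H (Y T) /\ (forall y, H y -> Y T y -> y = 1).
Proof.
move=> cH HX; have [sH clH] := cH; have [sX clX] := cX.
pose P T := X `<=` setmul H (Y T).
have [F FP totF|T [PT maxT]] := @Zorn_bigcup I P.
  move=> z Xz.
  have [F0|F0] := pselect (F !=set0); last first.
    apply: (sub_setmulr (K := Y _) sH); split=> // i [T FT]; exfalso.
    by apply: F0; exists T.
  (* For [T] in the chain, the elements [s] of [Y T] with [z] in [H s] form a descending family of
     nonempty closed sets; a common element works for the union. *)
  have [T FT|T FT|T1 T2 F1 F2|s sP] := @directed_meet G (set I) F
      (fun T => Y T `&` [set s | H (s * z^-1)]) cptG F0.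
  - apply: closedI; first by case: (cY T).
    by apply: (@closed_preim _ (fun s => s * z^-1)) => //; exact: continuous_mulr.
  - have [h [y [Hh [Yy zE]]]] := FP T FT z Xz.
    by exists y; split=> //=; rewrite zE invgM mulgA mulgV mul1g; exact: subgroupV.
  - have [s12|s21] := totF _ _ F1 F2.
      exists T2 => // s [[Xs Ns] Hs]; split; split=> //; split=> // i Ti.
      by apply: Ns; exact: s12.
    exists T1 => // s [[Xs Ns] Hs]; split; split=> //; split=> // i Ti.
    by apply: Ns; exact: s21.
  have [T0 FT0] := F0; have [[Xs _] Hs] := sP _ FT0.
  exists (s * z^-1)^-1, s; split; first exact: subgroupV.
  split; last by rewrite invgM invgK mulgVK.
  by split=> // i [T FT Ti]; have [[_ Ns] _] := sP _ FT; exact: Ns.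
exists T; split=> // y Hy Yy; apply: contrapT => y1.
have [i nNi] : exists i, ~ N i y.
  by apply/existsNP => Ny; apply: y1; apply: capN => //; case: Yy.
have nTi : ~ T i by move=> Ti; apply: nNi; case: Yy => _; apply.
apply: (maxT (T `|` [set i])).
  split; first by move=> j Tj; left.
  by move=> /(_ i (or_intror erefl)).
set T' := T `|` [set i]; have [sY' _] := cY T'.
have HY' : conj_stable H (Y T').
  apply: conj_stableI; first by move=> w h /HX Xw Xh; exact: subgroup_conj_stable.
  by apply: conj_stable_bigcap => j _ w h /HX; exact: XN.
have sHY := setmul_subgroup sH sY' HY'.
(* Modulo [Y T'], the element [y] of [H] is a nontrivial power of [x i], and this power generates
   [cyc (x i)]. *)
have xi : setmul H (Y T') (x i).
  have [k [n [Yn Nn yE]]] := peel nTi Yy.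
  have xk : x i ^+ k = y * n^-1 by rewrite yE mulgK.
  have [|m xm] := @prime_order_expK _ (x i) k (px i).
    by move=> e; apply: nNi; rewrite yE e mul1g.
  rewrite -xm; apply: subgroupX => //; rewrite xk.
  by exists y, n^-1; split=> //; split=> //; exact: subgroupV.
move=> z /PT[h [s [Hh [Ys ->]]]]; apply: subgroupM => //.
  exact: (sub_setmull sY').
have [k [n [Yn _ ->]]] := peel nTi Ys.
apply: subgroupM => //; last exact: (sub_setmulr sH).
exact: subgroupX.
Qed.

End Independent.

Section Complement.
Variables (I : Type) (x : I -> G) (X : set G).
Hypotheses (crX : int_cart_prod (fun i => cyc (x i)) X) (px : forall i, prime_order (x i)).

Let N i := closure (gen (\bigcup_(j in [set j | j <> i]) cyc (x j))).

Lemma cart_prod_closed_subgroup : closed_subgroup X.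
Proof.
have [_ [-> _]] := crX; apply: closure_closed_subgroup => //; exact: gen_subgroup.
Qed.

Lemma cart_prod_split i y : X y -> exists k n, N i n /\ y = x i ^+ k * n.
Proof.
have [nX [XE _]] := crX.
have cN : closed_subgroup (N i).
  by apply: closure_closed_subgroup => //; exact: gen_subgroup.
have [sC clC] : closed_subgroup (setmul (cyc (x i)) (N i)).
  apply: closed_subgroup_setmul => //.
    by split; [exact: cyc_subgroup|exact: closed_cyc].
  apply: conj_stable_closure => //; apply: conj_stable_gen; apply: conj_stable_bigcup => j _.
  have [_ [_ [_ [sub _]]]] := nX i; have [_ [_ [_ [_ nj]]]] := nX j.
  by move=> w h /sub; exact: nj.
have XC : X `<=` setmul (cyc (x i)) (N i).
  rewrite {1}XE; apply: closure_min => //; apply: gen_min => //.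
  move=> z [j _ xz]; have [ji|ji] := pselect (j = i).
    by apply: (sub_setmull (proj1 cN)); rewrite -ji.
  apply: (sub_setmulr (cyc_subgroup _)); apply: subset_closure; apply: mem_gen_set.
  by exists j.
move=> /XC [h [n [/(cycP _ (px i))[k ->] [Nn ->]]]].
by exists k, n.
Qed.

Lemma cart_prod_complement W H : (forall i, conj_stable W (cyc (x i))) ->
    closed_subgroup H -> H `<=` X ->
  exists K, [/\ closed_subgroup K, K `<=` X, conj_stable W K,
    X `<=` setmul H K & forall y, H y -> K y -> y = 1].
Proof.
move=> Wx cH HX; have [nX [XE capX]] := crX.
have cX := cart_prod_closed_subgroup.
have stN V i : (forall i, conj_stable V (cyc (x i))) -> conj_stable V (N i).
  move=> Vx; apply: conj_stable_closure => //; apply: conj_stable_gen.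
  by apply: conj_stable_bigcup => j _.
have cN i : closed_subgroup (N i).
  by apply: closure_closed_subgroup => //; exact: gen_subgroup.
have XN i : conj_stable X (N i) by apply: stN => j; have [_ [_ [_ [_ st]]]] := nX j; exact: st.
have Xx i : X (x i) by have [_ [_ [_ [sub _]]]] := nX i; apply: sub; exact: cyc_id.
have Nx i j : j <> i -> N j (x i).
  move=> ji; apply: subset_closure; apply: mem_gen_set; exists i; last exact: cyc_id.
  by move=> /= e; apply: ji.
have capN y : X y -> (forall i, N i y) -> y = 1.
  move=> Xy Ny; have : [set (1 : G)] y; last by [].
  by rewrite -capX; split=> // i _; exact: Ny.
have [T [XT HT]] := independent_complement cX cN XN px Xx Nx cart_prod_split capN cH HX.
exists (X `&` \bigcap_(i in T) N i); split => //.
- by apply: closed_subgroupI => //; apply: closed_subgroup_bigcap.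
- apply: conj_stableI; last by apply: conj_stable_bigcap => i _; exact: stN.
  rewrite XE; apply: conj_stable_closure => //; apply: conj_stable_gen.
  by apply: conj_stable_bigcup => i _.
Qed.

End Complement.

Lemma decomposition_profinite_C (A : set G) : decomposition A -> profinite_C G.
Proof.
move=> [B [J [I [b [a [cB [cA [[sB [nA [BA tiBA]]] [crB [crA [pb [pa na]]]]]]]]]]]] H cH.
have [sA clA] := cA; have [sH _] := cH.
have [Y [cY YA stY AY tiY]] := cart_prod_complement (W := setT) crA pa
  (fun i => (na i).2.2.2) (closed_subgroupI cH cA) (@subIsetr _ _ _).
have stYV V : conj_stable V Y by move=> w h _; exact: stY.
have cHY := closed_subgroup_setmul cH cY (stYV H).
have [sHY _] := cHY; have [sY _] := cY.
have AHY : A `<=` setmul H Y.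
  by move=> z /AY[h [y [[Hh _] [Yy ->]]]]; exists h, y.
have [Z [cZ ZB _ BZ tiZ]] := cart_prod_complement (W := set0) crB pb
  (fun _ _ _ => False_ind _) (closed_subgroupI cB cHY) (@subIsetl _ _ _).
have [sK clK] := closed_subgroup_setmul cZ cY (stYV Z).
exists (setmul Z Y); split=> //; split=> //; split.
  apply/seteqP; split=> // g _.
  (* Inverting turns [G = BA] into [G = AB]. Then [g = a b] with [a] in [H Y] and [b] in
     [(B :&: H Y) Z], so [g = h y z], and moving [z] to the left conjugates [y] within [Y]. *)
  have : [set: G] g^-1 by [].
  rewrite -BA => -[b' [a' [Bb [Aa gE]]]].
  have gE' : g = a'^-1 * b'^-1 by rewrite -invgM -gE invgK.
  have [h1 [z [[_ HY1] [Zz bE]]]] := BZ _ (subgroupV sB Bb).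
  have [h [y [Hh [Yy hE]]]] := subgroupM sHY (AHY _ (subgroupV sA Aa)) HY1.
  exists h, (z * (z^-1 * y * z)); split=> //; split.
    by exists z, (z^-1 * y * z); split=> //; split=> //; exact: stY.
  by rewrite gE' bE mulgA hE !mulgA mulgK.
apply/seteqP; split=> [g [Hg [z [y [Zz [Yy gE]]]]]|_ ->]; last first.
  by split; [exact: subgroup1|exact: subgroup1].
(* Here [z] lies in [B], [H Y] and [Z], so [z = 1]; then [g = y] lies in [H], [A] and [Y]. *)
have zE : z = g * y^-1 by rewrite gE mulgK.
have z1 : z = 1.
  apply: tiZ => //; split; first exact: ZB.
  by exists g, y^-1; split=> //; split=> //; exact: subgroupV.
have gy : g = y by rewrite gE z1 mul1g.
by apply: tiY; [split=> //; rewrite gy; exact: YA|rewrite gy].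
Qed.

End CartesianProducts.

(** * Decomposition of an abelian subgroup whose closed subgroups split off stably *)

Section AbelianDecomposition.
Variables (G : topGroupType) (hG : profinite G) (A W : set G).
Implicit Types (H K M N : set G) (F : set (set G)).
Hypotheses (cA : closed_subgroup A) (abA : forall x y, A x -> A y -> x * y = y * x).
Hypothesis WA : conj_stable W A.
Hypothesis splitA : forall H, closed_subgroup H -> H `<=` A ->
  exists N, [/\ closed_subgroup N, N `<=` A, conj_stable W N,
    A `<=` setmul H N & forall y, H y -> N y -> y = 1].

Let sA : is_subgroup A. Proof. by case: cA. Qed.
Let cptG : compact [set: G]. Proof. by case: hG => _ [_ [_ []]]. Qed.

(** Take an open subgroup [U] that misses [y], and split [M :&: U] off [A] with complement [N]. The
    [N]-component of [y] is a nontrivial element of [M :&: N], which meets [U] trivially, so it has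
    finite order. *)
Lemma exists_prime_order M y : closed_subgroup M -> M `<=` A -> M y -> y <> 1 ->
  exists2 x, M x & prime_order x.
Proof.
move=> cM MA My y1; have [sM _] := cM.
have [U [sU nU Uy]] := separate_subgroup hG y1.
have cU : closed_subgroup U by split=> //; exact: open_subgroup_closed.
have [|N [[sN _] NA _ AN tiN]] := splitA (closed_subgroupI cM cU).
  by move=> z [/MA].
have [d [n [[Md Ud] [Nn yE]]]] := AN y (MA _ My).
have Mn : M n by apply: (subgroup_divr sM Md); rewrite -yE.
have n1 : n <> 1 by move=> n1; apply: Uy; rewrite yE n1 mulg1.
have [|k pk] := exists_prime_order_of_discrete hG (subgroupI sN sM) sU nU _ (conj Nn Mn) n1.
  by move=> z [Nz Mz] Uz; exact: tiN.
by exists (n ^+ k) => //; exact: subgroupX.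
Qed.

Definition spans x N := forall y, A y -> exists k n, N n /\ y = x ^+ k * n.

(** Such an [N] has prime index in [A], the order of the witness [x]: it plays the kernel of a
    coordinate. *)
Definition hyperplane N := [/\ closed_subgroup N, N `<=` A, conj_stable W N
  & exists x, [/\ A x, prime_order x, ~ N x & spans x N]].

Lemma hyperplane_avoiding x : A x -> prime_order x ->
  exists N, [/\ hyperplane N, ~ N x & spans x N].
Proof.
move=> Ax px.
have [||N [cN NA WN AN tiN]] := splitA (H := cyc x).
- by split; [exact: cyc_subgroup|exact: closed_cyc].
- exact: cyc_min.
have Nx : ~ N x by move=> Nx; apply: (prime_order_neq1 px); apply: tiN => //; exact: cyc_id.
have spx : spans x N.
  by move=> y /AN[h [n [/(cycP _ px)[k ->] [Nn ->]]]]; exists k, n.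
by exists N; split=> //; split=> //; exists x.
Qed.

(** For an independent family with trivial intersection, this is the cyclic factor that belongs to
    [N]. *)
Let R F N := A `&` \bigcap_(N' in [set N' | F N' /\ N' <> N]) N'.

(* For a family of hyperplanes this means that the map from [A] to the product of the quotients is onto. *)
Let independent F := F `<=` hyperplane /\ forall N, F N -> A `<=` setmul N (R F N).

Let cR F N : F `<=` hyperplane -> closed_subgroup (R F N).
Proof.
move=> hF; apply: closed_subgroupI => //; apply: closed_subgroup_bigcap => N' [FN' _].
by have [] := hF _ FN'.
Qed.

Lemma independent_bigcup (C : set (set (set G))) : C `<=` independent ->
  total_on C subset -> independent (\bigcup_(F in C) F).
Proof.
move=> CI totC; split=> [N [F CF FN]|N [F0 CF0 F0N] c Ac]; first exact: (CI F CF).1.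
have hN : hyperplane N by exact: (CI F0 CF0).1.
have [[sN clN] _ _ _] := hN.
(* Only chain members containing [N] are used; larger ones leave fewer candidates [s] in [R F N]
   with [c] in [N s], and compactness gives a common one. *)
have [|F [CF FN]|F [CF FN]|F1 F2 [C1 F1N] [C2 F2N]|s sP] := @directed_meet G (set (set G)) [set F | C F /\ F N]
    (fun F => R F N `&` [set s | N (s * c^-1)]) cptG.
- by exists F0.
- apply: closedI; first by case: (@cR F N (CI F CF).1).
  by apply: (closed_preim (f := fun s => s * c^-1)) => //; exact: continuous_mulr.
- have [m [s [Nm [Rs cE]]]] := (CI F CF).2 N FN c Ac.
  by exists s; split=> //=; rewrite cE invgM mulgA mulgV mul1g; exact: subgroupV.
- have [F12|F21] := totC _ _ C1 C2.
    exists F2 => // s [[As Ns] Nsc]; split; split=> //; split=> // N' [F1N' N'N].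
    by apply: Ns; split=> //; exact: F12.
  exists F1 => // s [[As Ns] Nsc]; split; split=> //; split=> // N' [F2N' N'N].
  by apply: Ns; split=> //; exact: F21.
have [[As _] Nsc] := sP F0 (conj CF0 F0N).
exists (s * c^-1)^-1, s; split; first exact: subgroupV.
split; last by rewrite invgM invgK mulgVK.
split=> // N' [[F CF FN'] N'N].
have [F' [CF' F'N F'N']] : exists F', [/\ C F', F' N & F' N'].
  have [F0F|FF0] := totC _ _ CF0 CF; first by exists F; split=> //; exact: F0F.
  by exists F0; split=> //; exact: FF0.
by have [[_ Ns] _] := sP F' (conj CF' F'N); exact: Ns.
Qed.

(** If the members of a maximal family had a nontrivial intersection, it would contain some [x] of
    prime order, and a hyperplane avoiding [x] could be added. *)
Lemma maximal_independent_family : exists2 F, independent F &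
  forall y, A y -> (forall N, F N -> N y) -> y = 1.
Proof.
have [F [iF maxF]] := Zorn_bigcup independent_bigcup.
have [hF RF] := iF.
exists F => // y Ay Fy; apply: contrapT => y1.
have cM : closed_subgroup (A `&` \bigcap_(N in F) N).
  by apply: closed_subgroupI => //; apply: closed_subgroup_bigcap => N /hF [].
have [x [Ax Fx] px] := exists_prime_order cM (@subIsetl _ _ _) (conj Ay Fy) y1.
have [N0 [hN0 N0x spx]] := hyperplane_avoiding Ax px.
apply: (maxF (F `|` [set N0])).
  split; first by move=> N FN; left.
  by move=> /(_ N0 (or_intror erefl)) FN0; apply: N0x; exact: Fx.
split=> [N [/hF //|-> //]|N FN z Az].
have RxN N' : R F N' x by split=> // N'' [FN'' _]; exact: Fx.
have [NN0|NN0] := pselect (N = N0).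
  have [k [n [N0n zE]]] := spx z Az; have [[sN0 _] N0A _ _] := hN0.
  exists n, (x ^+ k); rewrite NN0; split=> //; split.
    split; first exact: subgroupX.
    move=> N' [[FN'|-> //] N'N0]; have [[sN' _] _ _ _] := hF _ FN'.
    by apply: subgroupX => //; exact: Fx.
  by rewrite zE; apply: abA; [exact: subgroupX|exact: N0A].
have {FN} FN : F N by case: FN.
have [[sN _] NA _ _] := hF _ FN.
(* For an old member [N], split the second factor as [x ^+ k * n0] with [n0] in [N0]. As [x] lies in
   every old member, its power moves into the factor from [N], and [n0] stays in the others. *)
have [m [r [Nm [Rr zE]]]] := RF N FN z Az.
have [k [n0 [N0n rE]]] := spx r (proj1 Rr).
have [sR _] := @cR F N hF.
have [An0 Rn0] : R F N n0 by apply: (subgroup_divr sR (subgroupX k sR (RxN N))); rewrite -rE.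
exists (m * x ^+ k), n0; split; first by apply: subgroupM => //; apply: subgroupX => //; exact: Fx.
split; last by rewrite zE rE mulgA.
by split=> // N' [[FN'|-> //] N'N]; exact: Rn0.
Qed.

(** The generator is the component [r] of [x] in [R F N]. Its power [r ^+ p] lies in both [N] and
    [R F N], so it is [1]. As [R F N] consists of powers of [r], the stability of the hyperplanes
    passes to [cyc r]. *)
Lemma independent_generator F N : independent F ->
    (forall y, A y -> (forall N, F N -> N y) -> y = 1) -> F N ->
  exists a, [/\ prime_order a, R F N a, spans a N & conj_stable W (cyc a)].
Proof.
move=> [hF RF] capF FN.
have [[sN _] NA WN [x [Ax px Nx spx]]] := hF _ FN; have [p [p_pr [_ [xp _]]]] := px.
have [sR _] := @cR F N hF.
have RN y : R F N y -> N y -> y = 1.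
  move=> [Ay Ry] Ny; apply: capF => // N' FN'.
  by have [->|N'N] := pselect (N' = N) => //; exact: Ry.
have [m [r [Nm [Rr xE]]]] := RF N FN x Ax; have [Ar _] := Rr.
have mr : m * r = r * m by apply: abA => //; exact: NA.
have pr : prime_order r.
  apply: (prime_orderP p_pr); last first.
    by move=> r1; apply: Nx; rewrite xE r1 mulg1.
  apply: RN; first exact: subgroupX.
  apply: (subgroup_divr sN (subgroupX p sN Nm)).
  by rewrite -expgMn // -xE xp; exact: subgroup1.
have spr : spans r N.
  move=> y /spx[k [n [Nn ->]]]; exists k, (m ^+ k * n); split.
    by apply: subgroupM => //; exact: subgroupX.
  by rewrite xE mr expgMn // mulgA.
exists r; split=> // w h Ww Rh.
have Rhw : R F N (w^-1 * h * w).
  apply: (@conj_stableI _ W A) => //.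
    by apply: conj_stable_bigcap => N' [/hF [_ _ WN' _] _].
  exact: (cyc_min sR Rr).
have [k [n [Nn hE]]] := spr _ (proj1 Rhw).
apply/(cycP _ pr); exists k; rewrite hE (RN n) ?mulg1 //.
by apply: (subgroup_divr sR (subgroupX k sR Rr)); rewrite -hE.
Qed.

Lemma abelian_cart_prod : exists (I : Type) (a : I -> G),
  [/\ forall i, prime_order (a i), forall i, conj_stable W (cyc (a i))
    & int_cart_prod (fun i => cyc (a i)) A].
Proof.
have [F iF capF] := maximal_independent_family; have [hF _] := iF.
pose I := {N | F N}.
have /choice[a aP] : forall i : I, exists a,
    [/\ prime_order a, R F (sval i) a, spans a (sval i) & conj_stable W (cyc a)].
  by move=> [N FN]; exact: independent_generator.
have pa i : prime_order (a i) by have [] := aP i.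
have cN (i : I) : closed_subgroup (sval i) by case: i => N /= /hF [].
have Aa i : A (a i) by have [_ []] := aP i.
have Na (i j : I) : j <> i -> sval j (a i).
  move=> ji; have [_ [_ Ra] _ _] := aP i; apply: Ra; split; first by case: (j).
  by move=> e; apply: ji; case: i j e => [N FN] [N' FN'] /= ?; exact: eq_exist.
have capN y : A y -> (forall i : I, sval i y) -> y = 1.
  by move=> Ay Ny; apply: capF => // N FN; exact: (Ny (exist _ N FN)).
have AN (i : I) : conj_stable A (sval i).
  move=> w h Aw Nh; have hA : A h by case: i Nh => N /= /hF [_ NA _ _]; exact: NA.
  by rewrite -mulgA (abA hA Aw) mulKg.
have sub1 (P : set I) : gen (\bigcup_(i in P) cyc (a i)) `<=` A.
  by apply: gen_min => // z [i _]; apply: cyc_min.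
exists I, a; split=> //; first by move=> i; have [] := aP i.
split; last split.
- move=> i; split; first exact: closed_cyc.
  split; first exact: cyc_subgroup.
  split=> //; split; first exact: cyc_min.
  move=> w h Aw ah; have hA : A h by exact: (cyc_min sA (Aa i)).
  by rewrite -mulgA (abA hA Aw) mulKg.
- set E := closure _.
  have cE : closed_subgroup E by apply: closure_closed_subgroup => //; exact: gen_subgroup.
  have EA : E `<=` A by apply: closure_min; [case: cA|exact: sub1].
  have Ea i : E (a i).
    by apply: subset_closure; apply: mem_gen_set; exists i => //; exact: cyc_id.
  (* To see that the [a i] generate [A] topologically, complement [E] by a subproduct. An index
     outside [T] would put [a i] in both [E] and the complement; so [T] is everything and the
     complement is trivial. *)
  have [T [AT tiT]] := independent_complement hG cA cN AN pa Aa Na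
    (fun i => let: And4 _ _ s _ := aP i in s) capN cE EA.
  apply/seteqP; split=> // y /AT[e [s [Ee [[As Ts] ->]]]].
  rewrite (capN s) ?mulg1 // => i; apply: Ts; apply: contrapT => nTi.
  apply: (prime_order_neq1 (pa i)); apply: tiT => //; split=> // j Tj.
  by apply: Na => ji; apply: nTi; rewrite -ji.
- apply/seteqP; split=> [y [Ay Ny]|_ ->].
    (* All generators other than [a i] lie in the hyperplane of index [i], and these hyperplanes
       meet trivially. *)
    apply: capN => // i; move: (Ny i Logic.I); apply: closure_min; first by case: (cN i).
    have [sN _] := cN i.
    by apply: gen_min => // z [j ji]; apply: cyc_min => //; apply: Na => e; apply: ji.
  split; first exact: subgroup1.
  by move=> i _; apply: subset_closure; exact: subgroup1 (gen_subgroup _).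
Qed.

End AbelianDecomposition.

(** * The decomposition over the closure of the derived subgroup *)

Lemma perm_complement_modular (G : topGroupType) (H K L : set G) :
    perm_complement H K -> is_subgroup L -> H `<=` L ->
  L `<=` setmul H (K `&` L) /\ forall y, H y -> (K `&` L) y -> y = 1.
Proof.
move=> [_ [HK tiHK]] sL HL; split=> [y Ly|y Hy [Ky _]]; last first.
  by have : [set (1 : G)] y by rewrite -tiHK; split.
have : [set: G] y by [].
rewrite -HK => -[h [k [Hh [Kk yE]]]]; exists h, k; split=> //; split=> //; split=> //.
by apply: (subgroup_divr sL (HL _ Hh)); rewrite -yE.
Qed.

Lemma derived_conj_stable (G : topGroupType) : conj_stable [set: G] (@derived G).
Proof.
apply: conj_stable_gen => w _ _ [x [y ->]].
exists (w^-1 * x * w), (w^-1 * y * w).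
by rewrite !invgM !invgK !mulgA !mulgK.
Qed.

Lemma decomposition_closure_derived (G : topGroupType) :
  profinite G -> profinite_C G -> decomposition (closure (@derived G)).
Proof.
move=> hG cG; pose A := closure (@derived G).
have cA : closed_subgroup A by apply: closure_closed_subgroup => //; exact: gen_subgroup.
have [sA clA] := cA.
have abA x y : A x -> A y -> x * y = y * x.
  by apply: closure_commute => // u v; exact: derived_commute.
have stA : conj_stable [set: G] A.
  by apply: conj_stable_closure => //; exact: derived_conj_stable.
have [B [[sB clB] cAB]] := cG A cA; have cB : closed_subgroup B by [].
have [_ [AB tiAB]] := cAB.
(* A commutator of elements of [B] lies in both [A] and [B]. *)
have abB x y : B x -> B y -> x * y = y * x.
  move=> Bx By; have : [set (1 : G)] (x^-1 * y^-1 * x * y).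
    rewrite -tiAB; split.
      by apply: subset_closure; apply: mem_gen_set; exists x, y.
    by do 3![apply: subgroupM => //]; exact: subgroupV.
  move=> /= e; apply: (mulgI y^-1); apply: (mulgI x^-1).
  by rewrite !mulgA e mulgVK mulVg.
have [|I [a [pa stC crA]]] := abelian_cart_prod (W := setT) hG cA abA stA.
  move=> H cH HA; have [K [[sK clK] cHK]] := cG H cH.
  have [AN tiN] := perm_complement_modular cHK sA HA.
  exists (K `&` A); split=> //; first exact: closed_subgroupI.
  move=> w n _ [Kn An]; split; last exact: stA.
  (* Write [w = h k] with [h] in [H] and [k] in [K]. As [h] and [n] lie in the abelian [A],
     conjugation of [n] by [w] is conjugation by [k], which stays in [K]. *)
  have : [set: G] w by [].
  have [_ [<- _]] := cHK => -[h [k [Hh [Kk ->]]]].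
  have -> : (h * k)^-1 * n * (h * k) = k^-1 * n * k.
    by rewrite invgM -!mulgA (mulgA n h) (abA n h An (HA _ Hh)) !mulgA mulgVK.
  exact: subgroup_conj_stable.
have [|J [b [pb _ crB]]] := abelian_cart_prod hG cB abB (subgroup_conj_stable sB).
  move=> H cH HB; have [K [[sK clK] cHK]] := cG H cH.
  have [AN tiN] := perm_complement_modular cHK sB HB.
  exists (K `&` B); split=> //; first exact: closed_subgroupI.
  move=> w n Bw [Kn Bn].
  by rewrite -mulgA (abB n w Bn Bw) mulKg.
exists B, J, I, b, a; split=> //; split=> //; split.
  split=> //; split; first by split=> //; split=> //; split.
  split; last by rewrite setIC.
  apply/seteqP; split=> // g _.
  have : [set: G] g^-1 by [].
  rewrite -AB => -[x [y [Ax [By gE]]]].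
  exists y^-1, x^-1; split; first exact: subgroupV.
  by split; [exact: subgroupV sA Ax|rewrite -invgM -gE invgK].
split=> //; split=> //; split=> //; split=> // i.
split; first exact: cyc_subgroup.
by split=> //; split=> //; exact: stC.
Qed.

Theorem theoremB (G : topGroupType) (hG : profinite G) :
  (profinite_C G <-> exists A : set G, decomposition A) /\
  (profinite_C G -> decomposition (closure (@derived G))).
Proof.
split; last exact: decomposition_closure_derived.
split=> [cG|[A dA]]; last exact: decomposition_profinite_C dA.
by exists (closure (@derived G)); exact: decomposition_closure_derived.
Qed.
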